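(* Let $d\ge 1$ be an integer and let $A,B\subset\mathbb{R}^d$ be finite sets with $|A|=m$. Assume that $B$ is proper $d$-dimensional and that $A\subset\operatorname{conv} B$. Let $k$ be a positive integer. Then $$|A+kB|\ge m\binom{d+k}{k}-k\binom{d+k}{k+1}=\left(m-\frac{kd}{k+1}\right)\binom{d+k}{k}.$$
   Context: A set in $\mathbb{R}^d$ is proper $d$-dimensional if it is not contained in any affine hyperplane. $\operatorname{conv} B$ denotes the convex hull of $B$. The sumset is $X+Y=\{x+y: x\in X,\ y\in Y\}$, and $kB=B+\dots+B$ ($k$ summands) is the $k$-fold sumset (not a dilate). $|X|$ denotes cardinality. *)

(* Defs.v *)
From mathcomp Require Import all_boot all_order all_algebra finmap.
From mathcomp Require Import classical_sets reals convex.

Set Implicit Arguments.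
Unset Strict Implicit.
Unset Printing Implicit Defensive.

Import Order.TTheory GRing.Theory Num.Theory.

Local Open Scope fset_scope.
Local Open Scope classical_set_scope.
Local Open Scope ring_scope.

Definition conv_hull (R : realType) (E : lmodType R) (B : set E) : set E :=
  smallest (@convex_set R E) B.

Definition affine_hyperplane (R : realType) (d : nat) (a : 'cV[R]_d) (c : R) :
    set 'rV[R]_d :=
  [set x | x *m a = c%:M].

Definition proper_dimensional (R : realType) (d : nat) (B : set 'rV[R]_d) :
    Prop :=
  forall (a : 'cV[R]_d) (c : R), a != 0 -> ~ (B `<=` affine_hyperplane a c).

Definition sumset (V : zmodType) (X Y : {fset V}) : {fset V} :=
  [fset x + y | x in X, y in Y].

(* [iterop k] gives exactly k summands when [0 < k]; the empty sum is {0}. *)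
Definition ksumset (V : zmodType) (k : nat) (B : {fset V}) : {fset V} :=
  iterop k (@sumset V) B [fset 0].

(* Main.v *)
Require Import Defs.
From mathcomp Require Import all_boot all_order all_algebra finmap.
From mathcomp Require Import boolp.

(** Triangulate conv B by the lower faces of a generic lifting of the points of
    B, and make the decomposition half-open: a point a is assigned the simplex
    S(a) entered from a in the direction of a fixed generic point q. If the k
    summands v are vertices of S(a), then (a + sum v) / (k + 1) is again
    assigned S(a), so equal sums a + sum v = a' + sum v' force S(a) = S(a').
    Then the barycentric coordinates of a and a' differ by integers, so either
    a = a' or both are vertices of S(a); in the latter case q lies inside S(a),
    and S(a) is one fixed simplex s0. Hence the m * 'C(d + k, k) sums overlap
    only for vertices of s0, where requiring each summand to come no earlier
    than a in a fixed order of the vertices removes the overlaps; this loses at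
    most (d + 1) * 'C(d + k, k) - 'C(d + k + 1, k + 1) = k * 'C(d + k, k + 1)
    sums. Points are represented by the homogeneous coordinates (1, x), so that
    sums need no normalisation. *)

Set Implicit Arguments.
Unset Strict Implicit.
Unset Printing Implicit Defensive.

Import Order.TTheory GRing.Theory Num.Theory.

Local Open Scope ring_scope.

(** * Coordinates with respect to sets of rows of a matrix *)

Definition supp_in (R : nzRingType) n (s : {set 'I_n}) (c : 'rV[R]_n) : Prop :=
  forall j, j \notin s -> c 0 j = 0.

Definition nneg (R : numDomainType) n (c : 'rV[R]_n) : Prop :=
  forall j, 0 <= c 0 j.

Lemma entryDZ (R : nzRingType) m n (A B : 'M[R]_(m, n)) t i j :
  (A + t *: B) i j = A i j + t * B i j.
Proof. by rewrite !mxE. Qed.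

Lemma entryBZ (R : nzRingType) m n (A B : 'M[R]_(m, n)) t i j :
  (A - t *: B) i j = A i j - t * B i j.
Proof. by rewrite !mxE. Qed.

Section Simplices.
Variables (R : realFieldType) (n d : nat) (M : 'M[R]_(n, d.+1)).
Implicit Types (s : {set 'I_n}) (c : 'rV[R]_n) (y : 'rV[R]_d.+1).

Definition subrows s : 'M[R]_(#|s|, d.+1) := rowsub enum_val M.

Definition is_basis s : bool := (#|s| == d.+1)%N && row_free (subrows s).

(** For rows [(1, b)] these are barycentric coordinates, padded with zeros to all [n] indices so
    that different simplices can be compared. The pseudo-inverse keeps them linear in [y] even when
    [s] is no basis. *)
Definition coords s y : 'rV[R]_n :=
  y *m pinvmx (subrows s) *m rowsub (enum_val (A := mem s)) 1%:M.

Lemma supp_inE s c : supp_in s c ->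
  exists u, c = u *m rowsub (enum_val (A := mem s)) 1%:M.
Proof.
move=> sc; exists (\row_i c 0 (enum_val i)).
apply/rowP=> j; rewrite !mxE.
have [js|js] := boolP (j \in s); last first.
  rewrite sc // big1 // => i _; rewrite !mxE.
  case: eqP => [E|_]; last by rewrite mulr0.
  by move: js; rewrite -E enum_valP.
rewrite (bigD1 (enum_rank_in js j)) //= !mxE enum_rankK_in // eqxx mulr1.
rewrite big1 ?addr0 // => i /eqP ni; rewrite !mxE.
case: eqP => [E|_]; last by rewrite mulr0.
by case: ni; apply: enum_val_inj; rewrite enum_rankK_in.
Qed.

(** Independence already bounds the size of [s] by the [d.+1] columns. *)
Lemma basisI s : (d < #|s|)%N ->
  (forall c, supp_in s c -> c *m M = 0 -> c = 0) -> is_basis s.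
Proof.
move=> ds inj; have rf : row_free (subrows s).
  apply: inj_row_free => v; rewrite /subrows rowsubE mulmxA => /inj E.
  have: v *m rowsub (enum_val (A := mem s)) 1%:M = 0.
    apply: E => j js; rewrite !mxE big1 // => i _; rewrite !mxE.
    case: eqP => [E|_]; last by rewrite mulr0.
    by move: js; rewrite -E enum_valP.
  move=> /rowP E'; apply/rowP => i; move: (E' (enum_val i)); rewrite !mxE.
  rewrite (bigD1 i) //= !mxE eqxx mulr1 big1 ?addr0 // => k /negbTE nki.
  by rewrite !mxE (inj_eq enum_val_inj) nki mulr0.
rewrite /is_basis rf andbT eqn_leq ds andbT.
by rewrite -[X in (X <= _)%N](eqP rf) rank_leq_col.
Qed.

Lemma coords_out s y : supp_in s (coords s y).
Proof.
move=> j js; rewrite !mxE big1 // => i _; rewrite !mxE.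
case: eqP => [E|_]; last by rewrite mulr0.
by move: js; rewrite -E enum_valP.
Qed.

Lemma coordsK s y : is_basis s -> coords s y *m M = y.
Proof.
case/andP=> /eqP cs rf; rewrite /coords -mulmxA -rowsubE mulmxKpV //.
by rewrite submx_full // /row_full (eqP rf) cs.
Qed.

Lemma mulmx_basis_inj s c c' : is_basis s -> supp_in s c -> supp_in s c' ->
  c *m M = c' *m M -> c = c'.
Proof.
case/andP=> /eqP cs rf /supp_inE[u ->] /supp_inE[v ->].
by rewrite -!mulmxA -!rowsubE => /(row_free_inj rf) ->.
Qed.

Lemma coords_uniq s c : is_basis s -> supp_in s c -> coords s (c *m M) = c.
Proof.
move=> bs sc; apply: (mulmx_basis_inj bs) => //; first exact: coords_out.
by rewrite coordsK.
Qed.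

Lemma coordsD s y z : coords s (y + z) = coords s y + coords s z.
Proof. by rewrite /coords !mulmxDl. Qed.

Lemma coordsZ s a y : coords s (a *: y) = a *: coords s y.
Proof. by rewrite /coords -!scalemxAl. Qed.

(** The ratio test: [t] is the largest step along [- e] that keeps [c] nonnegative, and [i] is a
    coordinate that this step brings to zero. *)
Lemma min_ratio c (e : 'rV[R]_n) (i0 : 'I_n) : nneg c -> 0 < e 0 i0 ->
  exists t i, [/\ 0 < e 0 i, t = c 0 i / e 0 i & forall j, t * e 0 j <= c 0 j].
Proof.
move=> c0 ei0.
case: (Order.TotalTheory.arg_minP (fun j => c 0 j / e 0 j)
  (P := fun j => 0 < e 0 j) ei0) => i ei min.
exists (c 0 i / e 0 i), i; split=> // j.
have [ej|ej] := ltP 0 (e 0 j).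
  by rewrite -ler_pdivlMr // min.
by apply: le_trans (c0 j); rewrite mulr_ge0_le0 // divr_ge0 // ltW.
Qed.

(** As long as the rows in the support are dependent, a step along a dependency empties one more
    coordinate and leaves [c *m M] unchanged. *)
Lemma caratheodory c : nneg c -> exists c', [/\ nneg c', c' *m M = c *m M &
  forall e, supp_in [set j | c' 0 j != 0] e -> e *m M = 0 -> e = 0].
Proof.
have [m] := ubnP #|[set j | c 0 j != 0]|; elim: m c => // m IH c cm c0.
have [E|] := pselect (forall e, supp_in [set j | c 0 j != 0] e ->
  e *m M = 0 -> e = 0); first by exists c.
move=> /existsNP[e /not_implyP[es /not_implyP[eM /eqP e0]]].
wlog [i0 ei0] : e es eM e0 / exists i, 0 < e 0 i.
  move=> wl; have /rV0Pn[i ei] := e0.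
  have [e_gt0|e_le0] := ltP 0 (e 0 i); first by apply: (wl e) => //; exists i.
  apply: (wl (- e)).
  - by move=> j js; rewrite mxE es // oppr0.
  - by rewrite mulNmx eM oppr0.
  - by rewrite oppr_eq0.
  - by exists i; rewrite mxE oppr_gt0 lt_neqAle ei.
have [t [i [ei te le]]] := min_ratio c0 ei0.
have [] := IH (c - t *: e).
- rewrite ltnS in cm; apply: leq_trans cm; apply: proper_card.
  apply/properP; split.
    apply/subsetP => j; rewrite !inE !mxE; apply: contra_neq => cj.
    by rewrite cj es ?mulr0 ?subr0 // inE cj eqxx.
  exists i; last by rewrite inE !mxE te divfK ?subrr ?eqxx // gt_eqF.
  rewrite inE; apply/eqP => ci; move: ei; rewrite es ?ltxx // inE ci eqxx //.
- by move=> j; rewrite !mxE subr_ge0.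
move=> c' [c'0 c'M ind]; exists c'; split=> //.
by rewrite c'M mulmxBl -scalemxAl eM scaler0 subr0.
Qed.

(** Nondegeneracy as in linear programming: if the coordinates of such a [y] in a basis are
    nonnegative, they are positive on that basis. *)
Definition generic y : Prop := forall s c, (#|s| <= d)%N -> supp_in s c ->
  c *m M != y.

Lemma generic_coords_gt0 s y : generic y -> is_basis s -> nneg (coords s y) ->
  forall j, j \in s -> 0 < coords s y 0 j.
Proof.
move=> gy bs c0 j js; rewrite lt_neqAle c0 andbT eq_sym; apply/eqP => cj.
case/andP: (bs) => /eqP cs _.
suff /eqP[] : coords s y *m M != y by rewrite coordsK.
apply: (gy (s :\ j)).
  by rewrite -ltnS -cs [X in (_ < X)%N](cardsD1 j) js.
by move=> i; rewrite !inE negb_and negbK => /orP[/eqP->//|/coords_out->].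
Qed.

Lemma generic_in_simplex y c : generic y -> nneg c -> c *m M = y ->
  exists2 s, is_basis s & nneg (coords s y).
Proof.
move=> gy c0 cy; have [c' [c'0 c'M ind]] := caratheodory c0.
set s := [set j | c' 0 j != 0] in ind.
have sc : supp_in s c' by move=> j; rewrite inE negbK => /eqP.
have bs : is_basis s.
  apply: basisI => //; rewrite ltnNge; apply/negP => cs.
  by have /eqP := gy s c' cs sc; apply; rewrite c'M.
by exists s => //; rewrite -cy -c'M coords_uniq.
Qed.

(** * The triangulation induced by a lifting *)

Section Triangulation.
Variable h : 'cV[R]_n.
Hypothesis M1 : forall j, M j 0 = 1.

(** [coords s (row j M) *m h] is the height, above point [j], of the hyperplane through the lifted
    vertices of [s]; thus [s] spans a lower face of the lifted points. *)
Definition lower s : bool :=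
  is_basis s && [forall j, (coords s (row j M) *m h) 0 0 <= h j 0].

(** An open cone over the simplex, so that sums of points can be tested without rescaling. *)
Definition cell s y : bool :=
  lower s && [forall j in s, 0 < coords s y 0 j].

Lemma sum_coords c : \sum_j c 0 j = (c *m M) 0 0.
Proof. by rewrite mxE; apply: eq_bigr => j _; rewrite M1 mulr1. Qed.

Lemma row_delta j : row j M = delta_mx 0 j *m M.
Proof. by rewrite rowE. Qed.

Lemma coords_vertex s j : is_basis s -> j \in s ->
  coords s (row j M) = delta_mx 0 j.
Proof.
move=> bs js; rewrite row_delta coords_uniq // => i; rewrite mxE /=.
by case: eqP => // ->; rewrite js.
Qed.

(* The simplex method: a feasible basis of minimal height is lower, as a
   violating row could be pivoted into it. *)
Lemma cell_exists y c : generic y -> nneg c -> c *m M = y ->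
  exists s, cell s y.
Proof.
move=> gy c0 cy; have [s0 bs0 ns0] := generic_in_simplex gy c0 cy.
pose P s := is_basis s && [forall j, 0 <= coords s y 0 j].
have Ps0 : P s0 by rewrite /P bs0; apply/forallP.
case: (Order.TotalTheory.arg_minP (fun s => (coords s y *m h) 0 0) Ps0).
move=> s /andP[bs /forallP ns] min; exists s.
have ps := generic_coords_gt0 gy bs ns.
apply/andP; split; last by apply/forall_inP.
apply/andP; split=> //; apply/forallP => b; rewrite leNgt; apply/negP => hb.
set g := coords s (row b M) in hb.
have bns : b \notin s.
  apply/negP => bs'; by move: hb; rewrite /g coords_vertex // -rowE mxE ltxx.
have gs : supp_in s g by apply: coords_out.
have gM : g *m M = row b M by apply: coordsK.
clearbody g.
have gb : g 0 b = 0 by apply: gs.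
(* The entries of [g] sum to 1, so one of them is positive. *)
have [i0 gi0] : exists i, 0 < g 0 i.
  apply/existsP; rewrite -[X in is_true X]negbK negb_exists; apply/negP.
  move=> /forallP gle; have := sum_coords g; rewrite gM mxE M1.
  have : \sum_j g 0 j <= 0 by apply: sumr_le0 => j _; rewrite leNgt gle.
  by move=> /[swap] ->; rewrite ler10.
(* The linear relation between row [b] and the rows in [s]; the pivot moves along it. *)
pose e := g - delta_mx 0 b.
have ne j : j != b -> e 0 j = g 0 j.
  by move=> jb; rewrite !mxE (negbTE jb) andbF subr0.
have i0b : i0 != b by apply: contraTneq gi0 => ->; rewrite gb ltxx.
have ei0 : 0 < e 0 i0 by rewrite ne.
have [t [i [ei te le]]] := min_ratio ns ei0.
have ib : i != b.
  apply: contraTneq ei => ->; rewrite !mxE gb !eqxx sub0r /= oppr_gt0.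
  by rewrite ltNge ler01.
have gi : 0 < g 0 i by rewrite -ne.
have ins : i \in s.
  by apply: contraTT gi => /gs ->; rewrite ltxx.
pose s' := b |: (s :\ i).
have eM : e *m M = 0 by rewrite mulmxBl gM -rowE subrr.
have bs' : is_basis s'.
  apply: basisI => [|f fs fM].
    rewrite cardsU1 !inE (negbTE bns) andbF /=.
    by case/andP: (bs) => /eqP cs _; move: cs; rewrite (cardsD1 i) ins /= => ->.
  (* Adding a multiple of [e] cancels entry [b] and leaves a relation on the basis [s]; its entry
     [i] is [f 0 b * e 0 i], which forces [f 0 b = 0]. *)
  have fe : f + f 0 b *: e = 0.
    apply: (mulmx_basis_inj bs).
    - move=> j js; rewrite !mxE.
      have [->|jb] := eqVneq j b; first by rewrite gb eqxx sub0r mulrN1 subrr.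
      rewrite fs; last by rewrite !inE (negbTE js) (negbTE jb) andbF.
      by rewrite gs // subrr mulr0 addr0.
    - by move=> j _; rewrite mxE.
    - by rewrite mulmxDl -scalemxAl fM eM scaler0 addr0 mul0mx.
  have fb : f 0 b = 0.
    move/rowP: fe => /(_ i) /eqP; rewrite entryDZ fs; last first.
      by rewrite !inE eqxx (negbTE ib).
    by rewrite [X in _ == X]mxE add0r mulf_eq0 (gt_eqF ei) orbF => /eqP.
  by rewrite -fe fb scale0r addr0.
have ce : coords s' y = coords s y - t *: e.
  have {1}-> : y = (coords s y - t *: e) *m M.
    by rewrite mulmxBl -scalemxAl eM scaler0 subr0 coordsK.
  rewrite coords_uniq // => j.
  rewrite !inE negb_or negb_and negbK => /andP[jb /orP[/eqP->|js]].
    by rewrite entryBZ te divfK ?subrr ?gt_eqF.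
  rewrite entryBZ ne //.
  by rewrite gs // coords_out // mulr0 subr0.
have Ps' : P s'.
  rewrite /P bs'; apply/forallP => j.
  by rewrite ce entryBZ subr_ge0.
(* The pivot lowers the height by [t] times the violation at [b], and [0 < t] because [y] is
   generic. *)
have := min _ Ps'; rewrite ce mulmxBl -scalemxAl mulmxBl -rowE.
rewrite entryBZ -[row b h]scale1r entryBZ [row b h 0 0]mxE mul1r.
have t0 : 0 < t by rewrite te divr_gt0 // ps.
rewrite lerBrDr gerDl leNgt mulr_gt0 // subr_gt0 //.
Qed.

Hypothesis hgen : forall s j, is_basis s -> j \notin s ->
  (coords s (row j M) *m h) 0 0 != h j 0.

(** The hyperplane over [s] lies below all lifted points, in particular those of [s'], so its height
    at [y] is at most that of [s']. By symmetry the heights agree; as the coordinates of [y] are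
    positive, every vertex of [s'] is then lifted onto the hyperplane over [s], and [hgen] puts it
    in [s]. *)
Lemma cell_uniq s s' y : cell s y -> cell s' y -> s = s'.
Proof.
have height u y' : is_basis u -> forall c, c *m M = y' ->
    (coords u y' *m h) 0 0 = \sum_j c 0 j * (coords u (row j M) *m h) 0 0.
  move=> bu c <-; rewrite /coords [c *m M]mulmx_sum_row !mulmx_suml summxE.
  by apply: eq_bigr => j _; rewrite -!scalemxAl mxE.
have le u v : cell u y -> cell v y ->
    (coords u y *m h) 0 0 <= (coords v y *m h) 0 0
    /\ ((coords u y *m h) 0 0 = (coords v y *m h) 0 0 -> v \subset u).
  move=> /andP[/andP[bu /forallP lu] _] /andP[/andP[bv _] /forall_inP pv].
  rewrite (height u y bu (coords v y)) ?coordsK //.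
  have -> : (coords v y *m h) 0 0 = \sum_j coords v y 0 j * h j 0.
    by rewrite mxE.
  have cv j : 0 <= coords v y 0 j.
    by have [/pv/ltW//|/coords_out->] := boolP (j \in v).
  have lt j : coords v y 0 j * (coords u (row j M) *m h) 0 0
       <= coords v y 0 j * h j 0 by rewrite ler_wpM2l.
  split; first exact: ler_sum.
  move=> E; apply/subsetP => j jv; apply/negPn/negP => ju.
  have : \sum_j (coords v y 0 j * h j 0
      - coords v y 0 j * (coords u (row j M) *m h) 0 0) == 0.
    by rewrite sumrB E subrr.
  rewrite psumr_eq0 => [/allP/(_ j)|i _]; last by rewrite subr_ge0.
  rewrite mem_index_enum => /(_ isT) /=; rewrite -mulrBr mulf_eq0.
  by rewrite gt_eqF ?pv //= subr_eq0 eq_sym (negbTE (hgen bu ju)).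
move=> cs cs'; have [l1 s1] := le _ _ cs cs'; have [l2 s2] := le _ _ cs' cs.
by apply/eqP; rewrite eqEsubset s1 ?s2 //; apply/eqP; rewrite eq_le l1 l2.
Qed.

End Triangulation.
End Simplices.

(* Points (t^j)_j of the moment curve, for t outside the roots of finitely many
   polynomials. *)
Lemma pos_avoid (R : realFieldType) n (vs : seq 'rV[R]_n) : 0 \notin vs ->
  exists h : 'cV[R]_n, (forall j, 0 < h j 0) /\
    forall v, v \in vs -> (v *m h) 0 0 != 0.
Proof.
move=> vs0; pose P := \prod_(v <- vs) rVpoly v.
have P0 : P != 0.
  rewrite prodf_seq_neq0; apply/allP => v vvs /=; apply: contraNneq vs0 => v0.
  by rewrite -(rVpolyK v) v0 linear0 in vvs.
(* These are [size P] distinct points, more than [P] has roots; starting at 1 makes the entries of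
   [h] positive. *)
pose rs : seq R := [seq i.+1%:R | i <- iota 0 (size P)].
have /allPn[_ /mapP[i _ ->] iP] : ~~ all (root P) rs.
  apply/negP => /(max_poly_roots P0); rewrite size_map size_iota ltnn => E.
  suff: false by []; apply: E; rewrite map_inj_uniq ?iota_uniq //.
  by move=> a b /eqP; rewrite eqr_nat eqSS => /eqP.
exists (\col_j i.+1%:R ^+ j); split=> [j|v vvs]; first by rewrite mxE exprn_gt0.
have <- : (rVpoly v).[i.+1%:R] = (v *m \col_j i.+1%:R ^+ j) 0 0.
  rewrite (horner_coef_wide _ (size_poly _ _)) mxE; apply: eq_bigr => j _.
  by rewrite coef_rVpoly_ord mxE.
apply: contra iP => iv; rewrite /P (perm_big _ (perm_to_rem vvs)) big_cons.
by rewrite rootM /root iv.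
Qed.

(** For each listed pair [(u, w)] with [u != 0], [u + e * w] has the sign of [u]. *)
Lemma small_perturbation (R : realFieldType) (l : seq (R * R)) :
  exists2 e : R, 0 < e & forall p, p \in l -> p.1 != 0 -> e * `|p.2| < `|p.1|.
Proof.
(* Allowing every smaller [e] lets the induction take a minimum. *)
suff [e0 e00 H] : exists2 e0 : R, 0 < e0 & forall e, 0 < e <= e0 ->
    forall p, p \in l -> p.1 != 0 -> e * `|p.2| < `|p.1|.
  by exists e0 => // p; apply: H; rewrite e00 lexx.
elim: l => [|[u w] l [e1 e10 IH]]; first by exists 1.
have [->|u0] := eqVneq u 0.
  exists e1 => // e /IH H p; rewrite inE => /orP[/eqP->|]; last exact: H.
  by rewrite eqxx.
have w1 : 0 < `|w| + 1 by rewrite ltr_wpDl.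
exists (Num.min e1 (`|u| / (`|w| + 1))).
  by rewrite lt_min e10 divr_gt0 // normr_gt0.
move=> e /andP[e0]; rewrite le_min => /andP[ee1 eu] p.
rewrite inE => /orP[/eqP-> _ /=|]; last by apply: IH; rewrite e0.
rewrite ler_pdivlMr // in eu; apply: lt_le_trans eu.
by rewrite ltr_pM2l // ltrDl.
Qed.

(** * Generic choices and the assignment of points to simplices *)

Section Assignment.
Variables (R : realFieldType) (n d : nat) (M : 'M[R]_(n, d.+1)).
Hypothesis M1 : forall j, M j 0 = 1.
Hypothesis Mfull : forall w : 'cV_d.+1, M *m w = 0 -> w = 0.

(** Each coincidence to avoid is a linear equation in [h], nontrivial because its coefficient at [j]
    is -1. *)
Lemma generic_heights : exists h : 'cV[R]_n,
  forall s j, is_basis M s -> j \notin s ->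
  (coords M s (row j M) *m h) 0 0 != h j 0.
Proof.
pose vs := [seq coords M p.1 (row p.2 M) - delta_mx 0 p.2 |
  p <- enum [pred p : {set 'I_n} * 'I_n | p.2 \notin p.1]].
have [|h [_ H]] := @pos_avoid R n vs.
  apply/mapP => -[[s j]]; rewrite mem_enum inE /= => js /rowP/(_ j)/eqP.
  rewrite -[delta_mx 0 j]scale1r entryBZ coords_out // [X in X == _]mxE.
  by rewrite mxE !eqxx mulr1 sub0r eq_sym oppr_eq0 oner_eq0.
exists h => s j _ js.
have := H (coords M s (row j M) - delta_mx 0 j).
have -> : coords M s (row j M) - delta_mx 0 j \in vs.
  by apply/mapP; exists (s, j) => //; rewrite mem_enum.
move=> /(_ isT); rewrite mulmxBl -rowE -[row j h]scale1r entryBZ mul1r.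
by rewrite [row j h 0 0]mxE subr_eq0.
Qed.

(** The columns span the linear functionals that vanish on the rows in [s], so genericity becomes
    finitely many inequalities. *)
Definition normals (s : {set 'I_n}) : 'M[R]_d.+1 := cokermx (subrows M s).

Lemma normals_eq0 s c : supp_in s c -> c *m M *m normals s = 0.
Proof.
case/supp_inE => u ->; rewrite -(mulmxA u) -rowsubE -mulmxA.
by rewrite mulmx_coker mulmx0.
Qed.

(** At most [d] rows do not span the whole space, so some nonzero column kills their span but not
    [y]. *)
Lemma generic_normal y :
  (forall s j, col j (normals s) != 0 -> (y *m col j (normals s)) 0 0 != 0) ->
  generic M y.
Proof.
move=> H s c cs sc; apply/eqP => E.
have [j nj] : exists j, col j (normals s) != 0.
  apply/existsP; rewrite -[X in is_true X]negbK negb_exists; apply/negP.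
  move=> /forallP n0; have : normals s = 0.
    apply/matrixP => i j; move: (n0 j); rewrite negbK => /eqP/colP/(_ i).
    by rewrite !mxE.
  move/eqP; rewrite -mxrank_eq0 mxrank_coker subn_eq0 leqNgt => /negP[].
  by apply: leq_ltn_trans (rank_leq_row _) _; rewrite ltnS.
have /eqP[] := H s j nj; rewrite -E -[X in _ *m X]/(col j _) colE mulmxA.
by rewrite normals_eq0 // mul0mx mxE.
Qed.

(** By [Mfull] a nonzero normal does not vanish on all rows, so each condition is a nontrivial one
    on the weights [g]. Nonnegative weights keep perturbed points in the cone of the rows. *)
Lemma generic_direction : exists g : 'rV[R]_n, nneg g /\
  forall s j, col j (normals s) != 0 -> (g *m M *m col j (normals s)) 0 0 != 0.
Proof.
pose vs := [seq (M *m col p.2 (normals p.1))^T |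
  p <- enum [pred p : {set 'I_n} * 'I_d.+1 | col p.2 (normals p.1) != 0]].
have [|h [h0 H]] := @pos_avoid R n vs.
  apply/mapP => -[[s j]]; rewrite mem_enum inE /= => nj /eqP.
  by rewrite eq_sym trmx_eq0 => /eqP/Mfull/eqP; rewrite (negbTE nj).
exists h^T; split=> [j|s j nj]; first by rewrite mxE ltW.
have := H (M *m col j (normals s))^T.
have -> : (M *m col j (normals s))^T \in vs.
  by apply/mapP; exists (s, j) => //; rewrite mem_enum.
by move=> /(_ isT); rewrite -[h]trmxK -trmx_mul trmxK mulmxA mxE.
Qed.

(* Each point is assigned the cell it enters when moved slightly towards a
   generic point, as in a half-open decomposition of the triangulation. *)
Lemma simplex_assignment (X : seq 'rV[R]_d.+1) :
  (forall x, x \in X -> exists2 c, nneg c & c *m M = x) ->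
  exists (S : 'rV[R]_d.+1 -> {set 'I_n}) (s0 : {set 'I_n}),
  [/\ forall x, x \in X -> is_basis M (S x),
      forall x, x \in X -> nneg (coords M (S x) x),
      forall x x' c c', x \in X -> x' \in X ->
        nneg c -> supp_in (S x) c -> nneg c' -> supp_in (S x') c' ->
        x + c *m M = x' + c' *m M -> S x = S x'
    & forall x x' j j', x \in X -> x' \in X -> S x = S x' ->
        j \in S x -> j' \in S x -> j != j' ->
        x = row j M -> x' = row j' M -> S x = s0].
Proof.
move=> HX; have [h hgen] := generic_heights.
have [g [g0 gq]] := generic_direction.
set q := g *m M in gq.
(* The first family of pairs makes [x + e *: q] generic; the second prevents a negative coordinate
   of [x] from becoming positive. *)
have [e e0 small] := small_perturbation
  ([seq ((x *m col p.2 (normals p.1)) 0 0, (q *m col p.2 (normals p.1)) 0 0) |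
     x <- X, p <- enum [set: {set 'I_n} * 'I_d.+1]] ++
   [seq (coords M p.1 x 0 p.2, coords M p.1 q 0 p.2) |
     x <- X, p <- enum [set: {set 'I_n} * 'I_n]]).
have gen x : x \in X -> generic M (x + e *: q).
  move=> xX; apply: generic_normal => s j nj.
  rewrite mulmxDl -scalemxAl entryDZ.
  have := small ((x *m col j (normals s)) 0 0, (q *m col j (normals s)) 0 0).
  rewrite mem_cat (_ : (_, _) \in _); last first.
    by apply/allpairsP; exists (x, (s, j)); rewrite mem_enum inE.
  move=> /(_ isT) /=; have [->|x0] := eqVneq ((x *m col j (normals s)) 0 0) 0.
    by move=> _; rewrite add0r mulf_neq0 ?gq // gt_eqF.
  move=> /(_ isT); rewrite addr_eq0; apply: contraTneq => ->.
  by rewrite normrN normrM (gtr0_norm e0) ltxx.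
have sgn x s j : x \in X -> 0 < coords M s (x + e *: q) 0 j ->
    0 <= coords M s x 0 j.
  move=> xX; rewrite coordsD coordsZ entryDZ => pos; rewrite leNgt.
  apply/negP => neg; have := small (coords M s x 0 j, coords M s q 0 j).
  rewrite mem_cat orbC (_ : (_, _) \in _); last first.
    by apply/allpairsP; exists (x, (s, j)); rewrite mem_enum inE.
  move=> /(_ isT) /=; rewrite lt_eqF // => /(_ isT).
  rewrite ltNge ltr0_norm // => /negP[].
  rewrite -[e]gtr0_norm // -normrM; apply: le_trans (ler_norm _).
  by rewrite -subr_ge0 opprK addrC ltW.
pose S y := odflt set0 [pick s | cell M h s y].
have SE s y : cell M h s y -> S y = s.
  rewrite /S; case: pickP => [s' c' c|/(_ s) -> //].
  exact: (cell_uniq hgen c' c).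
(* The exceptional simplex [s0] is the one around [q]. *)
exists (fun x => S (x + e *: q)), (S q).
have cS x : x \in X -> cell M h (S (x + e *: q)) (x + e *: q).
  move=> xX; have [c c0 cx] := HX x xX.
  have [s cs] : exists s, cell M h s (x + e *: q).
    apply: (@cell_exists _ _ _ M h M1 _ (c + e *: g)) => //; first exact: gen.
      by move=> j; rewrite entryDZ addr_ge0 // mulr_ge0 // ltW.
    by rewrite mulmxDl -scalemxAl cx.
  by rewrite (SE s).
have bS x : x \in X -> is_basis M (S (x + e *: q)).
  by move=> /cS /andP[/andP[]].
split=> //.
- move=> x xX j; have [js|/coords_out-> //] := boolP (j \in S (x + e *: q)).
  by apply: sgn => //; case/andP: (cS x xX) => _ /forall_inP; apply.
- move=> x x' c c' xX x'X c0 sc c'0 sc' E.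
  (* Adding nonnegative multiples of vertices of a cell keeps the coordinates positive, hence does
     not leave the cell. *)
  have cz y f : y \in X -> nneg f -> supp_in (S (y + e *: q)) f ->
      cell M h (S (y + e *: q)) (y + f *m M + e *: q).
    move=> yX f0 sf; case/andP: (cS y yX) => lo /forall_inP pos.
    apply/andP; split=> //; apply/forall_inP => j js.
    rewrite addrAC coordsD mxE coords_uniq ?bS //.
    by rewrite ltr_wpDr ?f0 ?pos.
  by apply: (cell_uniq hgen (cz x c xX c0 sc)); rewrite E; apply: cz.
move=> x x' j j' xX x'X E js j's jj' xj xj'.
apply/esym/SE; have bx := bS x xX.
case/andP: (cS x xX) => lo /forall_inP pos; apply/andP; split=> //.
case/andP: (cS x' x'X) => _ /forall_inP pos'; rewrite -E in pos'.
apply/forall_inP => i ins.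
(* At a vertex [k], the coordinates of [y + e *: q] other than the [k]-th are [e] times those of
   [q]. Two different vertices together cover all indices, so [q] lies in the cell. *)
have aux y k : k \in S (x + e *: q) -> y = row k M -> i != k ->
    0 < coords M (S (x + e *: q)) (y + e *: q) 0 i ->
    0 < coords M (S (x + e *: q)) q 0 i.
  move=> ks -> ik; rewrite coordsD coords_vertex // coordsZ entryDZ mxE.
  by rewrite (negbTE ik) andbF add0r pmulr_rgt0.
have [ij|ij] := eqVneq i j.
  by apply: (aux x' j') => //; [rewrite ij | apply: pos'].
by apply: (aux x j) => //; apply: pos.
Qed.

End Assignment.

(** * Counting multisets of vertices, written as nondecreasing tuples *)

Definition nondecr d k (t : k.-tuple 'I_d.+1) : bool := sorted leq (map val t).

Definition from_index d k (j : 'I_d.+1) (t : k.-tuple 'I_d.+1) : bool :=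
  path leq j (map val t).

Lemma card_nondecr m d k :
  #|[set p : 'I_m * k.-tuple 'I_d.+1 | nondecr p.2]| = (m * 'C(k + d, k))%N.
Proof.
rewrite -card_sorted_tuples -[in RHS](card_ord m) -cardsT -cardsX.
by apply: eq_card => p; rewrite !inE.
Qed.

(** Prepending [j] to [t] matches the remaining pairs with the nondecreasing tuples of length
    [k.+1]. *)
Lemma card_not_from_index d k :
  (#|[set p : 'I_d.+1 * k.-tuple 'I_d.+1 |
        nondecr p.2 && ~~ from_index p.1 p.2]|
   + 'C(k.+1 + d, k.+1) <= d.+1 * 'C(k + d, k))%N.
Proof.
pose P := [set p : 'I_d.+1 * k.-tuple 'I_d.+1 | nondecr p.2].
pose G := [set p : 'I_d.+1 * k.-tuple 'I_d.+1 | from_index p.1 p.2].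
have cG : ('C(k.+1 + d, k.+1) <= #|P :&: G|)%N.
  pose f (u : k.+1.-tuple 'I_d.+1) := (thead u, [tuple of behead u]).
  rewrite -card_sorted_tuples -(card_imset _ (f := f)); last first.
    move=> u v [uv1 uv2]; rewrite (tuple_eta u) (tuple_eta v).
    by apply: val_inj; rewrite /= uv1 uv2.
  apply: subset_leq_card; apply/subsetP => _ /imsetP[u su ->].
  move: su; rewrite !inE {1}(tuple_eta u) /= /nondecr /from_index /=.
  by move=> su; rewrite su andbT (path_sorted su).
rewrite -card_nondecr -(cardsID G P) addnC leq_add //.
by apply: subset_leq_card; apply/subsetP => p; rewrite !inE andbC.
Qed.

Lemma nneg_sum1_eq_delta (R : realFieldType) n (u : 'rV[R]_n) j :
  nneg u -> \sum_i u 0 i = 1 -> 1 <= u 0 j -> u = delta_mx 0 j.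
Proof.
move=> u0 su uj; have su' : u 0 j + \sum_(i | i != j) u 0 i = 1.
  by rewrite -su [RHS](bigD1 j).
have s0 : 0 <= \sum_(i | i != j) u 0 i by apply: sumr_ge0.
have uj1 : u 0 j = 1.
  by apply: le_anti; rewrite uj andbT -su' lerDl.
have /eqP : \sum_(i | i != j) u 0 i = 0.
  by apply: (addrI (u 0 j)); rewrite su' uj1 addr0.
rewrite psumr_eq0 // => /allP z; apply/rowP => i; rewrite mxE /=.
have [->|ij] := eqVneq i j; first by rewrite uj1.
by have := z i; rewrite mem_index_enum ij => /(_ isT)/eqP.
Qed.

(** The entries of [u] and [v] differ by integers. Where [u] exceeds [v] it does so by at least 1,
    so that entry of [u] carries the whole sum. *)
Lemma translate_eq_delta (R : realFieldType) n (u v : 'rV[R]_n)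
    (a b : 'I_n -> nat) :
  nneg u -> nneg v -> \sum_i u 0 i = 1 -> \sum_i v 0 i = 1 ->
  (forall i, u 0 i + (a i)%:R = v 0 i + (b i)%:R) -> u != v ->
  exists j, u = delta_mx 0 j.
Proof.
move=> u0 v0 su sv E uv.
have [j vuj] : exists j, v 0 j < u 0 j.
  apply/existsP; rewrite -[X in is_true X]negbK negb_exists; apply/negP.
  move=> /forallP le; case/eqP: uv; apply/rowP => i.
  have : \sum_i (v 0 i - u 0 i) == 0 by rewrite sumrB su sv subrr.
  rewrite psumr_eq0 => [/allP/(_ i)|k _]; last by rewrite subr_ge0 leNgt le.
  by rewrite mem_index_enum subr_eq0 => /(_ isT)/eqP.
exists j; apply: nneg_sum1_eq_delta => //.
have -> : u 0 j = v 0 j + ((b j)%:R - (a j)%:R).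
  by rewrite addrA -E addrK.
apply: le_trans (_ : (b j)%:R - (a j)%:R <= _); last by rewrite lerDr.
have ab : (a j < b j)%N.
  by rewrite -(ltr_nat R) -(ltrD2l (u 0 j)) E ltrD2r.
by rewrite -natrB ?ler1n ?subn_gt0 // ltnW.
Qed.

(** * Counting the sums *)

Section Counting.
Variables (R : realFieldType) (n d : nat) (M : 'M[R]_(n, d.+1)).
Hypothesis M1 : forall j, M j 0 = 1.
Hypothesis Mfull : forall w : 'cV_d.+1, M *m w = 0 -> w = 0.
Variable j0 : 'I_n.

(** A common index type for the vertices of all simplices: the same tuples serve each of them, and
    the order on indices orders the vertices of [s0]. *)
Definition vertex (s : {set 'I_n}) (i : 'I_d.+1) : 'I_n := nth j0 (enum s) i.

Definition mult s k (t : k.-tuple 'I_d.+1) : 'rV[R]_n :=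
  \sum_(i <- t) delta_mx 0 (vertex s i).

Lemma size_enum_basis s : is_basis M s -> size (enum s) = d.+1.
Proof. by case/andP=> /eqP + _; rewrite cardE. Qed.

Lemma vertex_in s i : is_basis M s -> vertex s i \in s.
Proof. by move=> /size_enum_basis cs; rewrite -mem_enum mem_nth // cs. Qed.

Lemma vertex_inj s : is_basis M s -> injective (vertex s).
Proof.
move=> /size_enum_basis cs i j /eqP.
by rewrite nth_uniq ?cs ?enum_uniq // => /eqP/val_inj.
Qed.

Lemma vertex_surj s j : is_basis M s -> j \in s -> exists i, j = vertex s i.
Proof.
move=> /size_enum_basis cs js.
have ij : (index j (enum s) < d.+1)%N by rewrite -cs index_mem mem_enum.
by exists (Ordinal ij); rewrite /vertex /= nth_index // mem_enum.
Qed.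

Lemma mult_entry s k (t : k.-tuple 'I_d.+1) j :
  mult s t 0 j = (count (fun i => vertex s i == j) t)%:R.
Proof.
rewrite summxE -sum1_count natr_sum [RHS]big_mkcond /=; apply: eq_bigr => i _.
by rewrite mxE eq_sym /=; case: eqP.
Qed.

Lemma mult_vertex s k (t : k.-tuple 'I_d.+1) i : is_basis M s ->
  mult s t 0 (vertex s i) = (count_mem i t)%:R.
Proof.
move=> bs; rewrite mult_entry; congr (_%:R); apply: eq_count => i' /=.
exact: inj_eq (vertex_inj bs) _ _.
Qed.

Lemma nneg_mult s k (t : k.-tuple 'I_d.+1) : nneg (mult s t).
Proof. by move=> j; rewrite mult_entry ler0n. Qed.

Lemma supp_mult s k (t : k.-tuple 'I_d.+1) :
  is_basis M s -> supp_in s (mult s t).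
Proof.
move=> bs j js; rewrite mult_entry (_ : count _ _ = 0%N) //.
apply/eqP; rewrite -leqn0 leqNgt -has_count; apply/hasPn => i _.
by apply: contra js => /eqP <-; apply: vertex_in.
Qed.

Lemma mult_inj s k (t t' : k.-tuple 'I_d.+1) : is_basis M s ->
  nondecr t -> nondecr t' -> mult s t = mult s t' -> t = t'.
Proof.
move=> bs st st' E; apply/val_inj/(inj_map val_inj).
apply: (sorted_eq leq_trans anti_leq) => //.
apply: perm_map; apply/allP => i _; apply/eqP/eqP.
by rewrite /= -(eqr_nat R) -!(mult_vertex _ _ bs) E.
Qed.

(** Comparing the coefficients at vertex [p] shows that [t'] contains [p], which comes before
    [p']. *)
Lemma not_from_of_eq s k (t t' : k.-tuple 'I_d.+1) (p p' : 'I_d.+1) :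
  is_basis M s ->
  (p < p')%N ->
  delta_mx 0 (vertex s p) + mult s t = delta_mx 0 (vertex s p') + mult s t' ->
  ~~ from_index p' t'.
Proof.
move=> bs pp' /rowP/(_ (vertex s p)); rewrite !mxE !eqxx /= !mult_vertex //.
rewrite (inj_eq (vertex_inj bs)) [p == p']lt_eqF //= add0r => /eqP.
rewrite -natrD eqr_nat => /eqP ct.
have pt : p \in tval t' by rewrite -has_pred1 has_count -ct.
apply/negP; rewrite /from_index (path_sortedE leq_trans).
move=> /andP[/allP/(_ (val p))].
by rewrite map_f // leqNgt pp' => /(_ isT).
Qed.

Theorem card_translates m k (x : 'I_m -> 'rV[R]_d.+1) (Y : {fset 'rV[R]_d.+1}) :
  injective x -> (forall i, exists2 c, nneg c & c *m M = x i) ->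
  (forall i, (x i) 0 0 = 1) ->
  (forall i (t : k.-tuple 'I_n), x i + \sum_(j <- t) row j M \in Y) ->
  (m * 'C(k + d, k) + 'C(k.+1 + d, k.+1)
     <= #|` Y| + d.+1 * 'C(k + d, k))%N.
Proof.
move=> xinj xM x1 HY.
have [|S [s0 [bS nS disj vS]]] := simplex_assignment M1 Mfull (X := codom x).
  by move=> _ /codomP[i ->].
have xX i : x i \in codom x by apply: codom_f.
pose P := [set p : 'I_m * k.-tuple 'I_d.+1 | nondecr p.2].
(* The discarded pairs: the point is vertex [j] of [s0] and the tuple may not follow [j]. On the
   other pairs in [P] the sum map [f] is injective. *)
pose bad (p : 'I_m * k.-tuple 'I_d.+1) j :=
  (x p.1 == row (vertex s0 j) M) && ~~ from_index j p.2.
pose E := [set p | [exists j, bad p j]].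
have cE : (#|P :&: E| + 'C(k.+1 + d, k.+1) <= d.+1 * 'C(k + d, k))%N.
  apply: leq_trans (card_not_from_index d k); rewrite leq_add2r.
  (* The vertex index determines the point because [x] is injective, so [g] is injective on the
     discarded pairs. *)
  pose g p := (odflt ord0 [pick j | bad p j], p.2).
  have gE p : p \in P :&: E -> bad p (g p).1.
    rewrite !inE => /andP[_ /existsP[j bj]]; rewrite /g /=.
    by case: pickP => //= /(_ j); rewrite bj.
  rewrite -(card_in_imset (f := g) (D := P :&: E)); last first.
    move=> p p' /gE/andP[/eqP xp _] /gE/andP[/eqP xp' _] gg.
    rewrite gg -xp' in xp; move: gg; rewrite /g => -[_]; move: xp => /xinj.
    by case: p p' {xp'} => [? ?] [? ?] /= -> ->.
  apply: subset_leq_card; apply/subsetP => _ /imsetP[p pE ->].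
  have /andP[_ nf] := gE p pE; move: pE; rewrite !inE => /andP[-> _] /=.
  exact: nf.
have cD : (#|P :\: E| <= #|` Y|)%N.
  pose f (p : 'I_m * k.-tuple 'I_d.+1) : 'rV[R]_d.+1 :=
    x p.1 + mult (S (x p.1)) p.2 *m M.
  have fY p : f p \in Y.
    have := HY p.1 [tuple of map (vertex (S (x p.1))) p.2].
    rewrite big_map /f /mult mulmx_suml.
    by under eq_bigr do rewrite rowE.
  have finj : {in P :\: E &, injective f}.
    move=> [i t] [i' t']; rewrite !inE /= => /andP[ne nt] /andP[ne' nt'] ff.
    have ss' : S (x i) = S (x i').
      apply: disj ff => //; try exact: nneg_mult; exact: supp_mult (bS _ _).
    move: ff; rewrite /f /= -ss' => /(congr1 (coords M (S (x i)))).
    have bs := bS (x i) (xX i); have u0 := nS (x i) (xX i).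
    have v0 := nS (x i') (xX i'); rewrite -ss' in v0.
    rewrite !coordsD !coords_uniq //; try exact: supp_mult.
    move: ne ne' bs u0 v0; set s := S (x i) in ss' *.
    move=> ne ne' bs u0 v0 E'.
    have [ii'|ii'] := eqVneq i i'.
      subst i'; congr (_, _); apply: (mult_inj bs) => //.
      exact: addrI E'.
    have su l : \sum_j coords M s (x l) 0 j = 1.
      by rewrite (sum_coords M1) coordsK.
    have uv : coords M s (x i) != coords M s (x i').
      apply: contra_neq ii' => uv; apply: xinj.
      by rewrite -(coordsK (x i) bs) uv coordsK.
    have Ej j := congr1 (fun c : 'rV_n => c 0 j) E'.
    have {}Ej j : coords M s (x i) 0 j + (count (fun i => vertex s i == j) t)%:R
       = coords M s (x i') 0 j + (count (fun i => vertex s i == j) t')%:R.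
      by have := Ej j; rewrite /= mxE [RHS]mxE !mult_entry.
    (* Different points with equal sums are both vertices of their common simplex, which must then
       be [s0]. *)
    have [j uj] := translate_eq_delta u0 v0 (su _) (su _) Ej uv.
    have [j' vj'] := translate_eq_delta v0 u0 (su _) (su _)
      (fun j => esym (Ej j)) (contra_neq esym uv).
    have jj' : j != j' by apply: contra_neq uv => jj; rewrite uj vj' jj.
    have in_s l z : coords M s (x l) = delta_mx 0 z -> z \in s.
      move=> lz; apply/negPn/negP => /(coords_out M (x l)).
      by rewrite lz mxE !eqxx => /eqP; rewrite oner_eq0.
    have row_ l z : coords M s (x l) = delta_mx 0 z -> x l = row z M.
      by move=> lz; rewrite rowE -lz coordsK.
    have ss0 : s = s0.
      apply: (vS _ _ j j' (xX i) (xX i')) => //.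
      - exact: in_s uj.
      - exact: in_s vj'.
      - exact: row_.
      - exact: row_.
    have [p jp] := vertex_surj bs (in_s _ _ uj).
    have [p' jp'] := vertex_surj bs (in_s _ _ vj').
    rewrite uj vj' jp jp' in E'.
    have pp' : p != p' by apply: contra_neq jj' => pp; rewrite jp jp' pp.
    (* The pair whose vertex comes later in the order was discarded, a contradiction. *)
    move: pp'; rewrite neq_ltn => /orP[lt|lt].
      case/existsP: ne'; exists p'; rewrite /bad /= (not_from_of_eq bs lt E').
      by rewrite -ss0 -jp' (row_ _ _ vj') eqxx.
    case/existsP: ne; exists p; rewrite /bad /=.
    rewrite (not_from_of_eq bs lt (esym E')).
    by rewrite -ss0 -jp (row_ _ _ uj) eqxx.
  rewrite cardE -(size_map f); apply: uniq_leq_size.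
    rewrite map_inj_in_uniq ?enum_uniq // => p p'; rewrite !mem_enum.
    exact: finj.
  by move=> _ /mapP[p _ ->].
rewrite -card_nondecr -(cardsID E P) [(#|P :&: E| + _)%N]addnC -addnA.
exact: leq_add cD cE.
Qed.

End Counting.

(* Homogeneous coordinates and the conclusion *)
From mathcomp Require Import classical_sets reals convex interval_inference.

Local Open Scope fset_scope.
Local Open Scope classical_set_scope.
Local Open Scope ring_scope.

Lemma mem_sumset (V : zmodType) (X Y : {fset V}) x y :
  x \in X -> y \in Y -> x + y \in sumset X Y.
Proof. by move=> xX yY; apply/imfset2P; exists x => //; exists y. Qed.

Lemma mem_ksumset (V : zmodType) (B : {fset V}) (s : seq V) :
  (0 < size s)%N -> all (mem B) s -> \sum_(v <- s) v \in ksumset (size s) B.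
Proof.
case: s => // v s _; rewrite /ksumset [size _]/= iteropS.
elim: s v => [|w s IH] v /=; first by rewrite big_seq1 andbT.
by case/andP=> vB ws; rewrite big_cons mem_sumset // IH.
Qed.

(** Turns the loss found by counting into the form of the theorem, by Pascal's rule and the relation
    [E] between neighbouring binomials. *)
Lemma binomial_identity d k :
  (d.+1 * 'C(k + d, k) = k * 'C(k + d, k.+1) + 'C(k.+1 + d, k.+1))%N.
Proof.
have E : (k.+1 * 'C(k + d, k.+1) = d * 'C(k + d, k))%N.
  by rewrite mul_bin_left addKn.
rewrite addSn binS [LHS]mulSn -E mulSn [LHS]addnC [RHS]addnA.
by rewrite [(k * _ + _)%N]addnC.
Qed.

Section Lift.
Variables (R : realType) (d : nat).

(** The level [a] is free because a sum of [k.+1] points at level 1 lies at level [k.+1]. *)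
Definition lift_point (a : R) (x : 'rV[R]_d) : 'rV[R]_(1 + d) := row_mx a%:M x.

Lemma lift_point0 a x : lift_point a x 0 0 = a.
Proof.
have -> : 0 = lshift d (0 : 'I_1) by apply: val_inj.
by rewrite row_mxEl mxE.
Qed.

Lemma lift_point_inj a : injective (lift_point a).
Proof. by move=> x y /eq_row_mx[]. Qed.

Lemma lift_pointD a b x y :
  lift_point (a + b) (x + y) = lift_point a x + lift_point b y.
Proof. by rewrite add_row_mx -raddfD. Qed.

Lemma sum_lift_point1 (s : seq 'rV[R]_d) :
  \sum_(v <- s) lift_point 1 v = lift_point (size s)%:R (\sum_(v <- s) v).
Proof.
elim: s => [|v s IH]; first by rewrite !big_nil /lift_point raddf0 row_mx0.
by rewrite !big_cons IH -lift_pointD nat1r.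
Qed.

Variable B : {fset 'rV[R]_d}.

Definition lift_points : 'M[R]_(#|` B|, 1 + d) :=
  \matrix_(j < #|` B|) lift_point 1 (nth 0 B j).

Lemma row_lift_points j : row j lift_points = lift_point 1 (nth 0 B j).
Proof. exact: rowK. Qed.

Lemma lift_points1 j : lift_points j 0 = 1.
Proof. by rewrite mxE [LHS]lift_point0. Qed.

(** A kernel vector is an affine function vanishing on [B]. A nonzero linear part would give a
    hyperplane containing [B]; the constant part then vanishes at any point of [B]. *)
Lemma lift_points_full : (0 < d)%N -> proper_dimensional [set` B] ->
  forall w : 'cV_(1 + d), lift_points *m w = 0 -> w = 0.
Proof.
move=> d0 hB w Mw.
have Bw x : x \in B -> usubmx w + x *m dsubmx w = 0.
  move=> xB; have jB : (index x B < #|` B|)%N by rewrite index_mem.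
  have := congr1 (row (Ordinal jB)) Mw.
  rewrite row_mul row_lift_points nth_index // row0 => <-.
  by rewrite -[in RHS](vsubmxK w) mul_row_col mul1mx.
have dw : dsubmx w = 0.
  apply/eqP/negPn/negP => /(hB _ (- w 0 0)); apply => x /= xB.
  rewrite /affine_hyperplane /=; apply/eqP; rewrite -subr_eq0.
  rewrite -(Bw x xB) addrC; apply/eqP; congr (_ + _).
  apply/matrixP => i j; rewrite !ord1 !mxE opprK; congr (w _ _).
  exact: val_inj.
(* An empty [B] would lie in a hyperplane, and one exists since [0 < d]. *)
have [x xB] : exists x, x \in B.
  apply: contrapT => nB.
  have : (const_mx 1 : 'cV[R]_d) != 0.
    apply/eqP => /colP/(_ (Ordinal d0)); rewrite !mxE => /eqP.
    by rewrite oner_eq0.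
  by move=> /(hB _ 0); apply => x /= xB; case: nB; exists x.
have := Bw x xB; rewrite dw mulmx0 addr0 => uw.
by rewrite -(vsubmxK w) uw dw col_mx0.
Qed.

(** The points whose lifts lie in the cone of the rows form a convex set containing [B]. *)
Lemma conv_hull_lift x : conv_hull [set` B] x ->
  exists2 c : 'rV[R]_#|` B|, nneg c & c *m lift_points = lift_point 1 x.
Proof.
move=> /(_ [set x | exists2 c : 'rV[R]_#|` B|, nneg c &
  c *m lift_points = lift_point 1 x]); apply; split; last first.
  move=> y /= yB; have jB : (index y B < #|` B|)%N by rewrite index_mem.
  exists (delta_mx 0 (Ordinal jB)); first by move=> j; rewrite mxE ler0n.
  by rewrite -rowE row_lift_points nth_index.
move=> y z t; rewrite !inE /= => -[c c0 cy] [c' c'0 c'z].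
have t0 : (0 : R) <= t%:inum by [].
have t1 : t%:inum <= 1 :> R by apply: le1.
exists (t%:inum *: c + (1 - t%:inum) *: c').
  move=> j; rewrite mxE [X in X + _]mxE [X in _ + X]mxE.
  by rewrite addr_ge0 // mulr_ge0 // subr_ge0.
rewrite mulmxDl -!scalemxAl cy c'z !scale_row_mx add_row_mx -scalerDl.
by rewrite addrC subrK scale1r.
Qed.

End Lift.

Theorem theorem1p5 (R : realType) (d m k : nat) (A B : {fset 'rV[R]_d})
    (hd : (1 <= d)%N) (hk : (1 <= k)%N) (hA : #|` A| = m)
    (hB : proper_dimensional [set` B])
    (hAB : [set` A] `<=` conv_hull [set` B]) :
  m%:R * 'C(d + k, k)%:R - k%:R * 'C(d + k, k.+1)%:R
    <= #|` sumset A (ksumset k B)|%:R :> R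
  /\ m%:R * 'C(d + k, k)%:R - k%:R * 'C(d + k, k.+1)%:R
     = (m%:R - (k%:R * d%:R) / (k%:R + 1)) * 'C(d + k, k)%:R :> R.
Proof.
split; last first.
  rewrite mulrBl; congr (_ - _); have k1 : k%:R + 1 != 0 :> R.
    by rewrite natr1 pnatr_eq0.
  apply: (mulIf k1); rewrite [RHS]mulrAC divfK // -!mulrA; congr (_ * _).
  by rewrite natr1 -!natrM mulnC mul_bin_left addnK.
have Mfull := lift_points_full hd hB.
(* Without rows the matrix would annihilate the nonzero all-ones vector. *)
have [j0] : inhabited 'I_#|` B|.
  apply: contrapT => nj; have /Mfull/colP/(_ 0)/eqP :
      lift_points B *m (const_mx 1 : 'cV_(1 + d)) = 0.
    by apply/colP => i; case: nj; constructor.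
  by rewrite !mxE oner_eq0.
pose x (i : 'I_m) := lift_point 1 (nth 0 A i).
have xA (i : 'I_m) : nth 0 A i \in A by rewrite mem_nth // hA.
have xinj : injective x.
  move=> i i' /lift_point_inj/eqP.
  by rewrite nth_uniq ?hA ?fset_uniq // => /eqP/val_inj.
have xconv i : exists2 c : 'rV[R]_#|` B|, nneg c & c *m lift_points B = x i.
  by apply: conv_hull_lift; apply: hAB; exact: xA.
pose Y := [fset lift_point k.+1%:R z | z in sumset A (ksumset k B)].
have HY i (t : k.-tuple 'I_#|` B|) :
    x i + \sum_(j <- t) row j (lift_points B) \in Y.
  pose s : seq 'rV[R]_d := [seq nth 0 B (val j) | j <- t].
  have ss : size s = k by rewrite size_map size_tuple.
  apply/imfsetP; exists (nth 0 A i + \sum_(v <- s) v) => /=.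
    apply: mem_sumset => //.
    rewrite -[in ksumset _ _]ss; apply: mem_ksumset; first by rewrite ss.
    by apply/allP => _ /mapP[j _ ->] /=; rewrite mem_nth.
  rewrite -(nat1r k) lift_pointD -[in k%:R]ss -sum_lift_point1 big_map.
  by under eq_bigr do rewrite row_lift_points.
have := card_translates (@lift_points1 _ _ B) Mfull j0 xinj xconv
  (fun i => lift_point0 1 _) HY.
rewrite (card_imfset _ _ (@lift_point_inj _ _ _)).
(* The term ['C(k.+1 + d, k.+1)] now occurs on both sides and cancels. *)
rewrite binomial_identity [(k + d)%N]addnC addnA leq_add2r => le.
by rewrite lerBlDr -!natrM -natrD ler_nat.
Qed.
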